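(* There exists an algorithm running in time $\mathcal{O}(|V|(|V|+|E|)^2)$ that determines whether a given graph $G=(V,E)$ is a triangle-free CDC graph.
   Context: All graphs are finite, simple, undirected, with nonempty vertex set. A graph is triangle-free if it has no three pairwise adjacent vertices. A clique is a set of pairwise adjacent vertices; it is maximal if it is not contained in a larger clique. A clique transversal of a graph is a set of vertices containing at least one vertex from each maximal clique; it is minimal if it contains no smaller clique transversal. A hypergraph is a pair $(V,E)$ with $V$ a finite set and $E$ a set of subsets of $V$ (hyperedges) such that every vertex belongs to a hyperedge; it is conformal if every set of vertices such that any two of them belong to a common hyperedge is itself contained in a hyperedge. A graph $G$ is clique dually conformal (CDC) if the hypergraph with vertex set $V(G)$ whose hyperedges are the minimal clique transversals of $G$ is conformal. *)

(* Defs.v *)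
From mathcomp Require Import all_boot.

Set Implicit Arguments.
Unset Strict Implicit.
Unset Printing Implicit Defensive.

Record sgraph := SGraph {
  vertex :> finType;
  edge : rel vertex;
  edge_sym : symmetric edge;
  edge_irr : irreflexive edge;
  vertex_gt0 : 0 < #|vertex|
}.

Definition edges (G : sgraph) : {set {set G}} :=
  [set A : {set G} | [exists x, exists y, edge x y && (A == [set x; y])]].

Definition triangle_free (G : sgraph) : bool :=
  ~~ [exists x : G, exists y : G, exists z : G,
        [&& edge x y, edge y z & edge x z]].

Definition clique (G : sgraph) (A : {set G}) : bool :=
  [forall x in A, forall y in A, (x != y) ==> edge x y].

Definition maximal_clique (G : sgraph) (A : {set G}) : bool :=
  maxset (@clique G) A.

Definition clique_transversal (G : sgraph) (S : {set G}) : bool :=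
  [forall A : {set G}, maximal_clique A ==> (S :&: A != set0)].

Definition min_clique_transversals (G : sgraph) : {set {set G}} :=
  [set S : {set G} | minset (@clique_transversal G) S].

Record hypergraph (V : finType) := Hypergraph {
  hyperedges : {set {set V}};
  hyperedges_cover : cover hyperedges = [set: V]
}.

Definition conformal (V : finType) (H : hypergraph V) : bool :=
  [forall X : {set V},
     [forall x in X, forall y in X, (x != y) ==>
        [exists A in hyperedges H, (x \in A) && (y \in A)]]
     ==> [exists A in hyperedges H, X \subset A]].

Lemma min_clique_transversals_cover (G : sgraph) :
  cover (min_clique_transversals G) = [set: G].
Proof.
apply/setP=> v; rewrite in_setT.
have cl1 : clique [set v].
  apply/forall_inP=> x /set1P->; apply/forall_inP=> y /set1P->.
  by rewrite eqxx.
have [C maxC vC] := maxset_exists cl1; rewrite sub1set in vC.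
have trS : clique_transversal (v |: ~: C).
  apply/forallP=> A; apply/implyP=> maxA.
  have [AC | /subsetPn[x xA xNC]] := boolP (A \subset C).
    have <- : C = A by case/maxsetP: maxA => _; apply=> //; case/maxsetP: maxC.
    by apply/set0Pn; exists v; rewrite !inE eqxx vC.
  by apply/set0Pn; exists x; rewrite !inE xNC orbT xA.
have [S minS SS] := minset_exists trS.
have trSS : clique_transversal S by case/minsetP: minS.
apply/bigcupP; exists S; first by rewrite inE.
have /implyP/(_ maxC)/set0Pn[x] := forallP trSS C.
rewrite inE => /andP[xS xC].
by have := subsetP SS x xS; rewrite !inE xC orbF => /eqP<-.
Qed.

Definition transversal_hypergraph (G : sgraph) : hypergraph G :=
  Hypergraph (min_clique_transversals_cover G).

Definition CDC (G : sgraph) : bool := conformal (transversal_hypergraph G).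

(** The model of computation is a word RAM with structured control flow: finitely
    many registers and random-access arrays (named by constants of the program),
    unit cost per operation, and every computed value, in particular every
    address, required to be smaller than a word bound [W].  A computation that
    exceeds the bound has no result. *)

Inductive binop := Add | Sub | Mul | Eq | Lt.

Inductive expr :=
  | Const of nat
  | Reg of nat
  | Get of nat & expr
  | Bin of binop & expr & expr.

Inductive cmd :=
  | Skip
  | SetReg of nat & expr
  | SetArr of nat & expr & expr
  | Seq of cmd & cmd
  | If of expr & cmd & cmd
  | While of expr & cmd.

Record state := State { reg : nat -> nat; arr : nat -> nat -> nat }.

Definition set_reg (st : state) (r v : nat) : state :=
  State [eta reg st with r |-> v] (arr st).

Definition set_arr (st : state) (a i v : nat) : state :=
  State (reg st) (fun b j => if (b == a) && (j == i) then v else arr st b j).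

Definition binop_sem (o : binop) (x y : nat) : nat :=
  match o with
  | Add => x + y
  | Sub => x - y
  | Mul => x * y
  | Eq => x == y
  | Lt => x < y
  end.

Definition word (W v : nat) : option nat := if v < W then Some v else None.

Fixpoint eval (W : nat) (st : state) (e : expr) : option nat :=
  match e with
  | Const n => word W n
  | Reg r => word W (reg st r)
  | Get a e1 => obind (fun i => word W (arr st a i)) (eval W st e1)
  | Bin o e1 e2 =>
      obind (fun x => obind (fun y => word W (binop_sem o x y)) (eval W st e2))
            (eval W st e1)
  end.

Fixpoint expr_cost (e : expr) : nat :=
  match e with
  | Const _ | Reg _ => 1
  | Get _ e1 => (expr_cost e1).+1
  | Bin _ e1 e2 => (expr_cost e1 + expr_cost e2).+1
  end.

(** [exec W c st t st']: started in [st], the command [c] halts in [st'] after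
    [t] unit-cost operations. *)
Inductive exec (W : nat) : cmd -> state -> nat -> state -> Prop :=
  | ExecSkip st : exec W Skip st 1 st
  | ExecSetReg st r e v :
      eval W st e = Some v ->
      exec W (SetReg r e) st (expr_cost e).+1 (set_reg st r v)
  | ExecSetArr st a e1 e2 i v :
      eval W st e1 = Some i -> eval W st e2 = Some v ->
      exec W (SetArr a e1 e2) st (expr_cost e1 + expr_cost e2).+1
        (set_arr st a i v)
  | ExecSeq st c1 c2 t1 st1 t2 st2 :
      exec W c1 st t1 st1 -> exec W c2 st1 t2 st2 ->
      exec W (Seq c1 c2) st (t1 + t2) st2
  | ExecIf st e c1 c2 v t st1 :
      eval W st e = Some v -> exec W (if v != 0 then c1 else c2) st t st1 ->
      exec W (If e c1 c2) st (expr_cost e + t).+1 st1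
  | ExecWhileEnd st e c :
      eval W st e = Some 0 ->
      exec W (While e c) st (expr_cost e).+1 st
  | ExecWhileLoop st e c v t1 st1 t2 st2 :
      eval W st e = Some v -> v != 0 ->
      exec W c st t1 st1 -> exec W (While e c) st1 t2 st2 ->
      exec W (While e c) st (expr_cost e + t1 + t2).+1 st2.

Lemma exec_det (W : nat) (c : cmd) (st : state) (t1 t2 : nat) (st1 st2 : state) :
  exec W c st t1 st1 -> exec W c st t2 st2 -> t1 = t2 /\ st1 = st2.
Proof.
move=> E; elim: E t2 st2 => {c st t1 st1}.
- by move=> st t2 st2 F; inversion F.
- by move=> st r e v ev t2 st2 F; inversion F; subst; split=> //; congruence.
- by move=> st a e1 e2 i v ev1 ev2 t2 st2 F; inversion F; subst;
    split=> //; congruence.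
- move=> st c1 c2 t1 st1 t1' st1' _ IH1 _ IH2 t2 st2 F.
  inversion F as [| | |? ? ? ? ? ? ? F1 F2| | |]; subst.
  by have [? ?] := IH1 _ _ F1; subst; have [? ?] := IH2 _ _ F2; subst.
- move=> st e c1 c2 v t st1 ev _ IH t2 st2 F.
  inversion F as [| | | |? ? ? ? ? ? ? ev' F1| |]; subst.
  rewrite ev in ev'; case: ev' => ?; subst.
  by have [? ?] := IH _ _ F1; subst.
- move=> st e c ev t2 st2 F.
  inversion F as [| | | | | |? ? ? ? ? ? ? ? ev' v0 F1 F2]; subst => //.
  by rewrite ev in ev'; case: ev' v0 => <-.
- move=> st e c v t1 st1 t1' st1' ev v0 _ IH1 _ IH2 t2 st2 F.
  inversion F as [| | | | |? ? ? ev'|? ? ? ? ? ? ? ? ev' v0' F1 F2]; subst.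
    by rewrite ev in ev'; case: ev' v0 => ->.
  by have [? ?] := IH1 _ _ F1; subst; have [? ?] := IH2 _ _ F2; subst.
Qed.

(** The input word sequence is stored in array 0; all other cells are 0. *)
Definition init (s : seq nat) : state :=
  State (fun=> 0) (fun a i => if a == 0 then nth 0 s i else 0).

(** [decides_in W c s t b]: on input [s], the program [c] halts in time [t] with
    answer [b], given as 0 or 1 in register 0. *)
Definition decides_in (W : nat) (c : cmd) (s : seq nat) (t : nat) (b : bool) :
    Prop :=
  exists2 st, exec W c (init s) t st & reg st 0 = b.

(** [s] lists the adjacency lists of [G]: the number of vertices, then for each
    vertex its degree followed by the numbers of its neighbours.  The numbering
    [vs] of the vertices and the order of each list are arbitrary. *)
Definition adjacency_code (G : sgraph) (s : seq nat) : Prop :=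
  exists (vs : seq G) (nbr : G -> seq G),
    [/\ uniq vs, vs =i G,
        forall v, uniq (nbr v) /\ nbr v =i edge v
      & s = size vs ::
            flatten [seq size (nbr v) :: [seq index u vs | u <- nbr v] | v <- vs]].

(* Main.v *)
Require Import Defs.
From mathcomp Require Import all_boot zify.

Set Implicit Arguments.
Unset Strict Implicit.
Unset Printing Implicit Defensive.

(** In a triangle-free graph the maximal cliques are the edges and the isolated
    vertices, so the minimal clique transversals are the minimal vertex covers
    enlarged by all isolated vertices. Call an edge [xy] bisimplicial when
    every neighbour of [x] is adjacent to every neighbour of [y]. A
    triangle-free graph is CDC if and only if every non-isolated vertex lies in
    a bisimplicial edge ([triangle_free_CDC]). Two facts carry the equivalence.

    - The ends of an edge [xy] lie in a common minimal transversal exactly when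
      [xy] is not bisimplicial ([cooccur_edge]): if [u] and [w] are
      non-adjacent neighbours of [x] and [y], a minimal transversal that avoids
      the independent set of [u] and [w] must contain [x] and [y]; conversely a
      minimal transversal containing [x] and [y] misses some neighbour of each,
      and two missed vertices cannot be adjacent.
    - A set of pairwise co-occurring vertices that is maximal for this property
      is a clique transversal ([maximal_cooccurring_transversal]).

    If some non-isolated [x] lies in no bisimplicial edge, then [x] and its
    neighbours co-occur pairwise, but no minimal transversal contains them all.
    Otherwise a maximal pairwise co-occurring set misses, for each of its
    non-isolated vertices [x], the other end of a bisimplicial edge at [x], so
    it is itself a minimal transversal.

    The criterion is evaluated with an adjacency matrix. For each of the at
    most [2|E|] ordered adjacent pairs, the algorithm spends [O(|V|^2)]
    operations, which is [O(|V|^2 |E|)] besides the [O(|V|^2)] spent on the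
    other pairs, and both are bounded by [|V| (|V| + |E|)^2].

    To verify the program, all its parts except the parser are written as
    nonrecursive Datalog-like rules: nested loops over the vertices, tests of
    stored binary relations, and the insertion of a pair into a relation. One
    induction ([compile_correct]) shows that a compiled rule computes the
    relation that it denotes within the time assigned to it; what remains is to
    read the denotations and to sum the costs. *)

(** * Triangle-free CDC graphs and bisimplicial edges *)

Section BisimplicialEdges.
Variable G : sgraph.
Implicit Types (x y u v w : G) (S X : {set G}).

Definition isolated x := [forall y, ~~ edge x y].

Lemma isolatedPn x : reflect (exists y, edge x y) (~~ isolated x).
Proof.
by rewrite negb_forall; apply: (iffP existsP) => -[y xy]; exists y;
  rewrite ?negbK // -[edge x y]negbK.
Qed.

Definition bisimplicial x y :=
  edge x y && [forall u, forall w, edge x u ==> edge y w ==> edge u w].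

Definition bisimplicially_covered :=
  [forall x, ~~ isolated x ==> [exists y, bisimplicial x y]].

Lemma edge_neq x y : edge x y -> x != y.
Proof. by apply: contraTneq => ->; rewrite edge_irr. Qed.

Lemma cliqueP S :
  reflect {in S &, forall x y, x != y -> edge x y} (clique S).
Proof.
apply: (iffP forall_inP) => [h x y xS yS | h x xS].
  by have /forall_inP/(_ y yS)/implyP := h x xS.
by apply/forall_inP=> y yS; apply/implyP; apply: h.
Qed.

Lemma clique1 x : clique [set x].
Proof. by apply/cliqueP=> y z /set1P-> /set1P->; rewrite eqxx. Qed.

Lemma clique2 x y : edge x y -> clique [set x; y].
Proof.
move=> xy; apply/cliqueP=> u w /set2P[->|->] /set2P[->|->] //;
  by rewrite ?eqxx // edge_sym.
Qed.

Section TriangleFree.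
Hypothesis tf : triangle_free G.

Lemma no_triangle x y z : edge x y -> edge y z -> edge x z -> False.
Proof.
move=> xy yz xz; case/negP: tf.
apply/existsP; exists x; apply/existsP; exists y; apply/existsP; exists z.
by rewrite xy yz.
Qed.

(** In a triangle-free graph the maximal cliques are exactly the edges and the
    singletons of isolated vertices. *)
Lemma clique_transversalP S :
  reflect ((forall x y, edge x y -> (x \in S) || (y \in S)) /\
           (forall x, isolated x -> x \in S))
          (clique_transversal S).
Proof.
apply: (iffP forallP) => [h | [hE hI] A]; first split.
- move=> x y xy; have /implyP/(_ _)/set0Pn := h [set x; y].
  case=> [|z]; last first.
    by rewrite !inE => /andP[zS /orP[] /eqP<-]; rewrite zS ?orbT.
  apply/maxsetP; split=> [|B /cliqueP cB sB]; first exact: clique2.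
  apply/eqP; rewrite eqEsubset sB andbT; apply/subsetP=> z zB; rewrite !inE.
  have [xB yB] : x \in B /\ y \in B by rewrite !(subsetP sB) ?set21 ?set22.
  have [//|zx] := eqVneq z x; have [//|zy] := eqVneq z y.
  by case: (no_triangle xy (z := z)); apply: cB; rewrite // eq_sym.
- move=> x /forallP ix; have /implyP/(_ _)/set0Pn := h [set x].
  case=> [|z]; last by rewrite !inE => /andP[zS /eqP<-].
  apply/maxsetP; split=> [|B /cliqueP cB]; first exact: clique1.
  rewrite sub1set => xB; apply/eqP; rewrite eqEsubset sub1set xB andbT.
  apply/subsetP=> z zB; rewrite inE; apply: contraR (ix z) => zx.
  by apply: cB; rewrite // eq_sym.
apply/implyP=> /maxsetP[/cliqueP cA mA]; apply/negP=> /eqP A0.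
have AS z : z \in A -> z \notin S.
  by move=> zA; apply/negP=> zS; have := in_set0 z; rewrite -A0 inE zA zS.
have [x xA] : exists x, x \in A.
  apply/set0Pn/eqP=> A0'; have /card_gt0P[x _] := vertex_gt0 G.
  have := mA _ (clique1 x); rewrite A0' => /(_ (sub0set _))/setP/(_ x).
  by rewrite !inE eqxx.
have [/hI xS | /isolatedPn[y xy]] := boolP (isolated x).
  by move: (AS x xA); rewrite xS.
have yS : y \in S by have := hE _ _ xy; rewrite (negPf (AS x xA)).
have sA : A \subset [set x; y].
  apply/subsetP=> z zA; rewrite !inE; have [//|zx] := eqVneq z x.
  have xz : edge x z by apply: cA; rewrite // eq_sym.
  by have := hE _ _ xz; rewrite (negPf (AS x xA)) (negPf (AS z zA)).
by move: (AS y); rewrite -(mA _ (clique2 xy) sA) set22 yS => /(_ isT).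
Qed.

(** A transversal is minimal when no vertex is redundant. Isolated vertices
    never are, and another vertex is needed exactly for an edge whose other end
    is missing. *)
Lemma min_clique_transversalP S :
  reflect (clique_transversal S /\
           {in S, forall x, ~~ isolated x -> exists2 y, edge x y & y \notin S})
          (S \in min_clique_transversals G).
Proof.
rewrite inE; apply: (iffP minsetP) => [[tS mS] | [tS pS]]; split=> //.
  move=> x xS nix; have [hE hI] := clique_transversalP _ tS.
  case: (pickP (fun y => edge x y && (y \notin S))) => [y /andP[]|no].
    by exists y.
  have inS y : edge x y -> y \in S.
    by move=> xy; have := no y; rewrite xy => /negbFE.
  suff tSx : clique_transversal (S :\ x).
    by have /setP/(_ x) := mS _ tSx (subD1set _ _); rewrite !inE eqxx xS.
  apply/clique_transversalP; split=> [u w uw | u iu].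
    have := hE _ _ uw; have nuw := edge_neq uw; rewrite !inE.
    have [ux|_] := eqVneq u x.
      by subst u; rewrite (inS w uw) eq_sym nuw.
    have [wx|//] := eqVneq w x; subst w.
    by rewrite (inS u) // edge_sym.
  by rewrite !inE hI // andbT; apply: contraNneq nix => <-.
move=> R tR sR; apply/eqP; rewrite eqEsubset sR; apply/subsetP=> x xS.
have [hE hI] := clique_transversalP _ tR.
have [/hI //|nix] := boolP (isolated x).
have [y xy yS] := pS x xS nix.
by have := hE _ _ xy; rewrite (contraNF (subsetP sR y) yS) orbF.
Qed.

(** Shrink the complement of [I], enlarged by the isolated vertices, to a
    minimal transversal: it avoids the non-isolated vertices of [I], so it has
    to contain all their neighbours. *)
Lemma min_clique_transversal_avoiding (I : {set G}) :
  {in I &, forall u w, ~~ edge u w} ->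
  exists2 S, S \in min_clique_transversals G &
    forall x i, i \in I -> edge x i -> x \in S.
Proof.
move=> indI; pose S0 := ~: (I :\: [set x | isolated x]).
have tS0 : clique_transversal S0.
  apply/clique_transversalP; split=> [x y xy | x ix]; rewrite !inE ?ix //.
  have [xI|] := boolP (x \in I); last by rewrite !andbF.
  have [yI|] := boolP (y \in I); last by rewrite !andbF orbT.
  by have := indI _ _ xI yI; rewrite xy.
have [S mS sS] := minset_exists tS0; exists S; first by rewrite inE.
move=> x i iI xi; have /minsetP[tS _] := mS.
have [/(_ _ _ xi) hE _] := clique_transversalP _ tS.
case/orP: hE => // /(subsetP sS); rewrite !inE iI andbT negbK => /forallP/(_ x).
by rewrite edge_sym xi.
Qed.

Definition cooccur x y :=
  [exists S in min_clique_transversals G, (x \in S) && (y \in S)].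

Lemma cooccurP x y :
  reflect (exists S, [/\ S \in min_clique_transversals G, x \in S & y \in S])
          (cooccur x y).
Proof.
apply: (iffP exists_inP) => [[S mS /andP[]]|[S [mS xS yS]]]; exists S => //.
by rewrite xS.
Qed.

Lemma cooccurC x y : cooccur x y = cooccur y x.
Proof. by apply: eq_existsb => S; rewrite [(x \in S) && _]andbC. Qed.

Lemma cooccurxx x : cooccur x x.
Proof.
have := in_setT x; rewrite -(min_clique_transversals_cover G).
by case/bigcupP=> S mS xS; apply/cooccurP; exists S.
Qed.

Lemma cooccur_edge x y : edge x y -> cooccur x y = ~~ bisimplicial x y.
Proof.
move=> xy; rewrite /bisimplicial xy; apply/idP/idP.
  case/cooccurP=> S [/min_clique_transversalP[tS pS] xS yS].
  have [hE _] := clique_transversalP _ tS.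
  have [|u xu uS] := pS x xS; first by apply/isolatedPn; exists y.
  have [|w yw wS] := pS y yS.
    by apply/isolatedPn; exists x; rewrite edge_sym.
  apply/negP=> /forallP/(_ u)/forallP/(_ w); rewrite xu yw /= => /hE.
  by rewrite (negPf uS) (negPf wS).
case/forallPn=> u /forallPn[w]; rewrite !negb_imply => /and3P[xu yw nuw].
have [|S mS hS] := min_clique_transversal_avoiding (I := [set u; w]).
  by move=> a b /set2P[->|->] /set2P[->|->]; rewrite ?edge_irr // edge_sym.
by apply/cooccurP; exists S; split=> //; [apply: (hS x u) | apply: (hS y w)];
  rewrite ?set21 ?set22.
Qed.

(** Avoiding the common neighbour [x] forces both [y] and [z]. *)
Lemma cooccur_neighbours x y z : edge x y -> edge x z -> cooccur y z.
Proof.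
move=> xy xz; have [|S mS hS] := min_clique_transversal_avoiding (I := [set x]).
  by move=> a b /set1P-> /set1P->; rewrite edge_irr.
apply/cooccurP; exists S; split=> //; apply: (hS _ x);
  by rewrite ?set11 1?edge_sym.
Qed.

Definition cooccurring X := [forall x in X, forall y in X, cooccur x y].

Lemma cooccurringP X :
  reflect {in X &, forall x y, cooccur x y} (cooccurring X).
Proof.
apply: (iffP forall_inP) => [h x y xX yX | h x xX].
  by have /forall_inP := h x xX; apply.
by apply/forall_inP=> y yX; apply: h.
Qed.

(** Conformality only tests pairs of distinct vertices; every vertex co-occurs
    with itself, so the diagonal may be included. *)
Lemma CDC_cooccurring :
  CDC G = [forall X, cooccurring X ==>
             [exists S in min_clique_transversals G, X \subset S]].
Proof.
apply: eq_forallb => X; congr (_ ==> _).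
apply: eq_forallb => x; congr (_ ==> _).
apply: eq_forallb => y; congr (_ ==> _).
by have [->|//] := eqVneq x y; rewrite cooccurxx.
Qed.

Lemma maximal_cooccurring_extension X a :
  maxset cooccurring X -> a \notin X -> exists2 b, b \in X & ~~ cooccur a b.
Proof.
case/maxsetP=> /cooccurringP cX mX aX.
case: (pickP (fun b => (b \in X) && ~~ cooccur a b)) => [b /andP[]|no].
  by exists b.
have co b : b \in X -> cooccur a b.
  by move=> bX; have := no b; rewrite bX => /negbFE.
suff caX : cooccurring (a |: X).
  by have /setP/(_ a) := mX _ caX (subsetUr _ _); rewrite !inE eqxx (negPf aX).
apply/cooccurringP=> b c /setU1P[->|bX] /setU1P[->|cX'].
- exact: cooccurxx.
- exact: co.
- by rewrite cooccurC co.
- exact: cX.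
Qed.

(** If [X] missed both ends of an edge [uv], it would contain a vertex [a] that
    never occurs with [u] and a vertex [b] that never occurs with [v].  But [a]
    and [b] occur in a common minimal transversal, which meets [uv]. *)
Lemma maximal_cooccurring_transversal X :
  maxset cooccurring X -> clique_transversal X.
Proof.
move=> mX; have /cooccurringP cX := maxsetp mX.
apply/clique_transversalP; split=> [u v uv | x ix].
  apply/norP=> -[/(maximal_cooccurring_extension mX)[a aX nua]].
  case/(maximal_cooccurring_extension mX)=> b bX nvb.
  have /cooccurP[S [mS aS bS]] := cX a b aX bX.
  have /min_clique_transversalP[/clique_transversalP[/(_ _ _ uv) hE _] _] := mS.
  case/orP: hE => [uS|vS].
    by case/cooccurP: nua; exists S.
  by case/cooccurP: nvb; exists S.
apply: contraT => /(maximal_cooccurring_extension mX)[a aX /cooccurP[]].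
have /cooccurP[S [mS aS _]] := cooccurxx a; exists S; split=> //.
by have /min_clique_transversalP[/clique_transversalP[_ hI] _] := mS; apply: hI.
Qed.

(** The closed neighbourhood of [x] is the only obstruction: it is never
    contained in a minimal transversal when [x] is not isolated. *)
Theorem triangle_free_CDC : CDC G = bisimplicially_covered.
Proof.
rewrite CDC_cooccurring; apply/forallP/forallP=> [cdc x | cov X]; apply/implyP.
  case/isolatedPn=> z xz; apply: contraT => /existsPn nobis.
  pose X := x |: [set y | edge x y].
  have co y : edge x y -> cooccur x y by move=> xy; rewrite cooccur_edge.
  have /implyP/(_ _)/exists_inP[|S mS sX] := cdc X.
    apply/cooccurringP=> a b; rewrite !inE => /predU1P[->|xa] /predU1P[->|xb].
    - exact: cooccurxx.
    - exact: co.
    - by rewrite cooccurC co.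
    - exact: cooccur_neighbours xa xb.
  have /min_clique_transversalP[_ pS] := mS.
  have [||y xy] := pS x; first by rewrite (subsetP sX) // setU11.
    by apply/isolatedPn; exists z.
  by rewrite (subsetP sX) // !inE xy orbT.
case/maxset_exists=> Y mY sXY; have /cooccurringP cY := maxsetp mY.
apply/exists_inP; exists Y => //; apply/min_clique_transversalP; split.
  exact: maximal_cooccurring_transversal.
move=> x xY nix; have /implyP/(_ nix)/existsP[y bxy] := cov x.
have xy : edge x y by case/andP: bxy.
exists y => //; apply/negP=> yY.
by have := cY x y xY yY; rewrite cooccur_edge // bxy.
Qed.

End TriangleFree.
End BisimplicialEdges.

(** * Timed total correctness for the word RAM *)

(** A Hoare triple for total correctness with a bound on the running time. *)
Definition runs (W : nat) (c : cmd) (P Q : state -> Prop) (T : nat) : Prop :=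
  forall st, P st -> exists t st', [/\ exec W c st t st', Q st' & t <= T].

Section Runs.
Variable W : nat.
Implicit Types (c : cmd) (e : expr) (P Q R : state -> Prop).

Lemma runs_weaken c P Q T P' Q' T' :
  runs W c P' Q' T' -> (forall st, P st -> P' st) ->
  (forall st, Q' st -> Q st) -> T' <= T -> runs W c P Q T.
Proof.
move=> h hP hQ hT st /hP/h[t [st' [ex /hQ q le]]].
by exists t, st'; split=> //; apply: leq_trans hT.
Qed.

Lemma runs_seq c1 c2 P Q R T1 T2 :
  runs W c1 P Q T1 -> runs W c2 Q R T2 -> runs W (Seq c1 c2) P R (T1 + T2).
Proof.
move=> h1 h2 st /h1[t1 [st1 [ex1 /h2[t2 [st2 [ex2 r le2]]] le1]]].
by exists (t1 + t2), st2; split=> //; [apply: ExecSeq ex2 | apply: leq_add].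
Qed.

Lemma runs_setreg r e P Q :
  (forall st, P st -> exists2 v, eval W st e = Some v & Q (set_reg st r v)) ->
  runs W (SetReg r e) P Q (expr_cost e).+1.
Proof.
by move=> h st /h[v ev q]; do 2 eexists; split; [apply: ExecSetReg ev| |].
Qed.

Lemma runs_setarr a e1 e2 P Q :
  (forall st, P st -> exists i v,
     [/\ eval W st e1 = Some i, eval W st e2 = Some v
       & Q (set_arr st a i v)]) ->
  runs W (SetArr a e1 e2) P Q (expr_cost e1 + expr_cost e2).+1.
Proof.
by move=> h st /h[i [v [ev1 ev2 q]]]; do 2 eexists; split;
  [apply: ExecSetArr ev1 ev2| |].
Qed.

(** The test has the same known value in all states satisfying [P], which makes
    the time bound depend on the branch. *)
Lemma runs_guard e c (b : bool) P Q T :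
  (forall st, P st -> eval W st e = Some (nat_of_bool b)) ->
  (if b then runs W c P Q T else forall st, P st -> Q st) ->
  runs W (If e c Skip) P Q (expr_cost e + (if b then T else 1)).+1.
Proof.
move=> ev h st Pst; case: b ev h => ev h.
  have [t [st' [ex q le]]] := h _ Pst.
  exists (expr_cost e + t).+1, st'; split=> //; last by rewrite ltnS leq_add2l.
  exact: ExecIf (ev _ Pst) ex.
exists (expr_cost e + 1).+1, st; split=> //; last exact: h.
exact: ExecIf (ev _ Pst) (ExecSkip _ _).
Qed.

(** The number [N] of iterations is known in advance, and the bound may charge
    a different time to each of them. *)
Lemma runs_while e c (I : nat -> state -> Prop) N (T : nat -> nat) :
  (forall i st, i <= N -> I i st -> eval W st e = Some (nat_of_bool (i < N))) ->
  (forall i, i < N -> runs W c (I i) (I i.+1) (T i)) ->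
  runs W (While e c) (I 0) (I N)
    (\sum_(0 <= i < N) (T i + (expr_cost e).+1) + (expr_cost e).+1).
Proof.
move=> ev h; suff gen m i : i + m = N -> runs W (While e c) (I i) (I N)
    (\sum_(i <= j < N) (T j + (expr_cost e).+1) + (expr_cost e).+1).
  exact: (gen N).
elim: m i => [|m IH] i.
  rewrite addn0 => -> st IN; exists (expr_cost e).+1, st.
  split=> //; last by rewrite big_geq.
  by apply: ExecWhileEnd; rewrite (ev N) // ltnn.
move=> imN; have iN : i < N by rewrite -imN -addSnnS leq_addr.
move=> st Ii; have [t1 [st1 [ex1 Ii1 le1]]] := h _ iN _ Ii.
have [|t2 [st2 [ex2 IN le2]]] := IH i.+1 _ _ Ii1; first by rewrite addSnnS.
exists (expr_cost e + t1 + t2).+1, st2; split=> //.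
  by apply: ExecWhileLoop ex1 ex2; rewrite ?(ev i) ?iN // ltnW.
by rewrite big_ltn //; lia.
Qed.

End Runs.

(** * Rules that compute a relation from stored relations *)

(** Variables are numbered by binding depth, from the outside in.  [Put i j]
    inserts the pair of the values of variables [i] and [j] into the relation
    being computed, [Guard b a i j r] continues with [r] when membership of the
    pair in relation [a] is [b], and [Loop r] binds the next variable to each
    vertex in turn. *)
Inductive rule :=
  | Put of nat & nat
  | Guard of bool & nat & nat & nat & rule
  | Loop of rule.

(** Register 0 holds the number of vertices and register [i.+1] the number of
    the vertex bound to variable [i]; relation [a] is stored in array [a] as a
    0/1 matrix, row by row. *)
Definition cell i j : expr :=
  Bin Add (Bin Mul (Reg i.+1) (Reg 0)) (Reg j.+1).

Definition literal (b : bool) a i j : expr :=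
  if b then Get a (cell i j) else Bin Eq (Get a (cell i j)) (Const 0).

Definition increment r : cmd := SetReg r (Bin Add (Reg r) (Const 1)).

(** [k] is the array receiving the result and [d] the number of bound
    variables. *)
Fixpoint compile (k d : nat) (r : rule) : cmd :=
  match r with
  | Put i j => SetArr k (cell i j) (Const 1)
  | Guard b a i j r => If (literal b a i j) (compile k d r) Skip
  | Loop r =>
      Seq (SetReg d.+1 (Const 0))
          (While (Bin Lt (Reg d.+1) (Reg 0))
                 (Seq (compile k d.+1 r) (increment d.+1)))
  end.

(** A rule may not read the relation [k] that it writes, so that its meaning
    does not change while it runs, nor array 0, which holds the input. *)
Fixpoint well_formed (k d : nat) (r : rule) : bool :=
  match r with
  | Put i j => (i < d) && (j < d)
  | Guard _ a i j r => [&& 0 < a, a != k, i < d, j < d & well_formed k d r]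
  | Loop r => well_formed k d.+1 r
  end.

(** Variable 0 is a fixed vertex, so the loops bind variables 1 and 2. *)
Definition over_arcs (r : rule) : rule := Loop (Loop (Guard true 1 1 2 r)).

Section Rules.
Variables (G : sgraph) (x0 : G).
Implicit Types (B : nat -> rel G) (rho : seq G).

(** A database [B] gives the relation stored in each array; [rho] lists the
    values of the bound variables. The default [x0] of [nth] is never reached
    on well-formed rules. *)
Fixpoint rule_rel B rho (r : rule) : rel G := fun x y =>
  match r with
  | Put i j => (x == nth x0 rho i) && (y == nth x0 rho j)
  | Guard b a i j r =>
      (B a (nth x0 rho i) (nth x0 rho j) == b) && rule_rel B rho r x y
  | Loop r => [exists z, rule_rel B (rcons rho z) r x y]
  end.

(** The constants bound the exact numbers of operations: 7 for an insertion, at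
    most 10 for a test, 6 to set up and leave a loop, and 8 per iteration. *)
Fixpoint cost B rho (r : rule) : nat :=
  match r with
  | Put _ _ => 10
  | Guard b a i j r =>
      10 + (if B a (nth x0 rho i) (nth x0 rho j) == b then cost B rho r else 0)
  | Loop r => 10 + \sum_(z : G) (10 + cost B (rcons rho z) r)
  end.

Definition insert B k (X : rel G) : nat -> rel G :=
  fun j x y => B j x y || ((j == k) && X x y).

Lemma insert_other B k X j : j != k -> insert B k X j =2 B j.
Proof. by move=> /negPf jk x y; rewrite /insert jk orbF. Qed.

Lemma rule_rel_insert B k X d r rho :
  well_formed k d r -> rule_rel (insert B k X) rho r =2 rule_rel B rho r.
Proof.
move=> wfr x y; elim: r d rho wfr => //= [b a i j r IH|r IH] d rho.
  by case/and5P=> _ ak _ _ /IH->; rewrite insert_other.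
by move/IH=> h; apply: eq_existsb => z.
Qed.

Lemma cost_insert B k X d r rho :
  well_formed k d r -> cost (insert B k X) rho r = cost B rho r.
Proof.
elim: r d rho => //= [b a i j r IH|r IH] d rho.
  by case/and5P=> _ ak _ _ /IH->; rewrite insert_other.
by move/IH=> h; congr (_ + _); apply: eq_bigr => z _; rewrite h.
Qed.

Fixpoint depth (r : rule) : nat :=
  match r with
  | Put _ _ => 0 | Guard _ _ _ _ r => depth r | Loop r => (depth r).+1
  end.

Fixpoint weight (r : rule) : nat :=
  match r with
  | Put _ _ => 10 | Guard _ _ _ _ r => 10 + weight r | Loop r => 20 + weight r
  end.

Lemma sum_vertices_const c : \sum_(x : G) c = #|G| * c.
Proof. by rewrite sum_nat_const; congr (_ * _); apply: eq_card. Qed.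

Lemma cost_le B rho r : cost B rho r <= weight r * #|G| ^ depth r.
Proof.
have n0 := vertex_gt0 G.
elim: r rho => /= [i j|b a i j r IH|r IH] rho; first by rewrite muln1.
  rewrite mulnDl leq_add //; last by case: ifP.
  by rewrite leq_pmulr // expn_gt0 n0.
apply: (@leq_trans (10 + \sum_(z : G) (10 + weight r * #|G| ^ depth r))).
  by rewrite leq_add2l leq_sum // => z _; rewrite leq_add2l.
rewrite sum_vertices_const expnS mulnDr mulnCA mulnDl addnA leq_add2r.
have : #|G| <= #|G| * #|G| ^ depth r by rewrite leq_pmulr // expn_gt0 n0.
move: (_ * _ ^ _) => N; lia.
Qed.

Definition arc_number := \sum_(x : G) \sum_(y : G) edge x y.

(** Only adjacent pairs pay for the body, which replaces a factor [#|G| ^ 2] by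
    the number of arcs. *)
Lemma cost_over_arcs B r : B 1 =2 @edge G ->
  cost B [:: x0] (over_arcs r)
    <= 50 * #|G| ^ 2 + arc_number * (weight r * #|G| ^ depth r).
Proof.
move=> BE; rewrite /=.
set K := weight r * _; have n0 := vertex_gt0 G.
apply: (@leq_trans
  (10 + \sum_(x : G) (20 + \sum_(y : G) (20 + edge x y * K)))).
  rewrite leq_add2l leq_sum // => x _.
  rewrite addnA leq_add2l leq_sum // => y _.
  rewrite addnA leq_add2l BE eqb_id; case: edge => //; rewrite mul1n.
  exact: cost_le.
under eq_bigr do rewrite big_split /= sum_vertices_const -big_distrl addnA /=.
rewrite big_split /= sum_vertices_const -big_distrl /= addnA leq_add2r -mulnn.
rewrite mulnDr mulnA; have : #|G| <= #|G| * #|G| by rewrite leq_pmulr.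
by move: #|G| n0 => n n0 h; lia.
Qed.

(** Here [m] stands for the number of edges. *)
Lemma cost_over_arcs_le B r m :
  B 1 =2 @edge G -> depth r <= 2 -> arc_number <= 2 * m ->
  cost B [:: x0] (over_arcs r) <= (50 + 2 * weight r) * (#|G| * (#|G| + m) ^ 2).
Proof.
move=> BE d2 le_m; apply: leq_trans (cost_over_arcs r BE) _.
have n0 := vertex_gt0 G; rewrite mulnDl -!mulnn; apply: leq_add.
  rewrite leq_mul2l (leq_trans (leq_pmull (#|G| * #|G|) n0)) //.
  by rewrite leq_mul2l leq_mul ?leq_addr ?orbT.
apply: (@leq_trans (2 * m * (weight r * #|G| ^ 2))).
  by rewrite leq_mul // leq_mul2l leq_pexp2l // orbT.
rewrite mulnACA leq_mul2l; apply/orP; right.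
by rewrite -mulnn mulnCA leq_mul2l mulnC leq_mul ?orbT // (leq_addr, leq_addl).
Qed.

Section Correct.
Variables (W : nat) (vs : seq G).
Hypothesis vs_uniq : uniq vs.
Hypothesis vsE : vs =i G.
Hypothesis W_large : #|G|.+1 ^ 2 <= W.

Lemma size_vs : size vs = #|G|.
Proof. by rewrite -(card_uniqP vs_uniq); apply: eq_card. Qed.

Lemma mem_vs x : x \in vs.
Proof. by rewrite vsE. Qed.

Lemma index_vs x : index x vs < #|G|.
Proof. by rewrite -size_vs index_mem mem_vs. Qed.

Definition cell_index x y := index x vs * #|G| + index y vs.

Lemma cell_index_eq x y x' y' :
  (cell_index x y == cell_index x' y') = (x == x') && (y == y').
Proof.
apply/eqP/andP=> [h|[/eqP-> /eqP->] //].
have n0 := vertex_gt0 G.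
have idx z z' : index z vs = index z' vs -> z = z'.
  exact: (index_inj x0 (mem_vs z) (mem_vs z')).
split; apply/eqP/idx.
  by have := congr1 (divn^~ #|G|) h;
    rewrite /cell_index !divnMDl // !divn_small ?index_vs // !addn0.
by have := congr1 (modn^~ #|G|) h;
  rewrite /cell_index !modnMDl !modn_small ?index_vs.
Qed.

Lemma word_small v : v < #|G|.+1 ^ 2 -> word W v = Some v.
Proof. by rewrite /word => h; rewrite (leq_trans h W_large). Qed.

Lemma word_le v : v <= #|G| -> word W v = Some v.
Proof.
move=> h; apply: word_small; rewrite -mulnn.
exact: leq_trans (leq_pmulr _ _).
Qed.

Lemma word_bool (b : bool) : word W b = Some (nat_of_bool b).
Proof. by apply: word_le; apply: leq_trans (vertex_gt0 G); case: b. Qed.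

Lemma word_cell_index x y : word W (cell_index x y) = Some (cell_index x y).
Proof.
apply/word_small/(@leq_trans ((index x vs).+1 * #|G|)).
  by rewrite mulSn [ltnRHS]addnC ltn_add2l index_vs.
by rewrite -mulnn leq_mul ?index_vs // ltnW // ltnS index_vs.
Qed.

(** The state represents the database [B] and the variable assignment [rho].
    Array 0 and the registers beyond the bound variables are left free. *)
Definition stores rho B st : Prop :=
  [/\ reg st 0 = #|G|,
      forall i, i < size rho -> reg st i.+1 = index (nth x0 rho i) vs
    & forall k x y, 0 < k -> arr st k (cell_index x y) = B k x y].

Lemma stores_ext rho B B' st :
  (forall k, 0 < k -> B k =2 B' k) -> stores rho B st -> stores rho B' st.
Proof. by move=> eB [h0 hr ha]; split=> // k x y k0; rewrite ha // eB. Qed.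

Lemma stores_rcons rho z B st :
  stores (rcons rho z) B st <->
  stores rho B st /\ reg st (size rho).+1 = index z vs.
Proof.
split=> [[h0 hr ha]|[[h0 hr ha] hz]]; split=> //.
- split=> // i i_lt; rewrite hr ?size_rcons; last exact: ltnW.
  by rewrite nth_rcons i_lt.
- by rewrite hr ?size_rcons // nth_rcons ltnn eqxx.
- move=> i; rewrite size_rcons nth_rcons ltnS leq_eqVlt.
  by case: eqVneq => [->|_] /=; rewrite ?ltnn // => i_lt; rewrite i_lt hr.
Qed.

Lemma stores_set_reg rho B st r v :
  size rho < r -> stores rho B st -> stores rho B (set_reg st r v).
Proof.
move=> lt [h0 hr ha]; split=> // [|i i_lt] /=.
  by rewrite ifN // neq_ltn (leq_ltn_trans _ lt).
by rewrite ifN ?hr // neq_ltn (leq_ltn_trans i_lt lt).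
Qed.

Lemma eval_cell rho B st i j :
  stores rho B st -> i < size rho -> j < size rho ->
  eval W st (cell i j) = Some (cell_index (nth x0 rho i) (nth x0 rho j)).
Proof.
move=> [h0 hr ha] hi hj; rewrite /= h0 !hr // !(word_le (ltnW (index_vs _))) /=.
rewrite (word_le (leqnn _)) /= word_small /= ?word_cell_index //.
by rewrite -mulnn ltn_mul // ltnS // ltnW // index_vs.
Qed.

Lemma eval_literal rho B st b a i j :
  stores rho B st -> 0 < a -> i < size rho -> j < size rho ->
  eval W st (literal b a i j) =
    Some (nat_of_bool (B a (nth x0 rho i) (nth x0 rho j) == b)).
Proof.
move=> hst a0 hi hj; have ec := eval_cell hst hi hj; case: hst => _ _ ha.
have eg : eval W st (Get a (cell i j)) =
    Some (nat_of_bool (B a (nth x0 rho i) (nth x0 rho j))).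
  (* Unfold a single layer of [eval], keeping the address expression folded. *)
  change (obind (fun l => word W (arr st a l)) (eval W st (cell i j)) =
    Some (nat_of_bool (B a (nth x0 rho i) (nth x0 rho j)))).
  by rewrite ec /= ha // word_bool.
case: b; rewrite /literal; first by rewrite eg eqb_id.
change (obind (fun v => obind (fun w => word W (v == w)) (word W 0))
  (eval W st (Get a (cell i j))) =
  Some (nat_of_bool (B a (nth x0 rho i) (nth x0 rho j) == false))).
by rewrite eg /= (word_bool false) /= word_bool; case: (B _ _ _).
Qed.

(** During a loop, array [k] gains the union of the relations denoted by the
    body over the vertices treated so far; since the body does not read array
    [k], it keeps the denotation and the cost that it has in [B]. *)
Lemma compile_correct k r rho B :
  0 < k -> well_formed k (size rho) r ->
  runs W (compile k (size rho) r)
    (stores rho B) (stores rho (insert B k (rule_rel B rho r))) (cost B rho r).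
Proof.
move=> k0; elim: r rho B => [i j|b a i j r IH|r IH] rho B /=.
- case/andP=> hi hj; apply: runs_weaken (fun _ h => h) (fun _ h => h) _.
    apply: runs_setarr => st hst; do 2 eexists; split.
    + exact: eval_cell hst hi hj.
    + exact: (word_bool true).
    case: hst => h0 hr ha; split=> // l x y l0 /=.
    by rewrite cell_index_eq ha // /insert; case: ifP => _; rewrite ?orbT ?orbF.
  by [].
- case/and5P=> a0 ak hi hj wfr.
  apply: runs_weaken (fun _ h => h) (fun _ h => h) _.
    apply: runs_guard => [st hst|]; first exact: eval_literal hst a0 hi hj.
    case: eqP => _; first exact: IH.
    by move=> st; apply: stores_ext => l l0 x y; rewrite /insert andbF orbF.
  by case: (b); case: ifP => _ /=; lia.
- move=> wfr.
  pose X i x y := [exists z in take i vs, rule_rel B (rcons rho z) r x y].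
  pose I i st := stores rho (insert B k (X i)) st /\ reg st (size rho).+1 = i.
  pose T i := cost B (rcons rho (nth x0 vs i)) r + 4.
  have init : runs W (SetReg (size rho).+1 (Const 0)) (stores rho B) (I 0) 2.
    apply: runs_setreg => st hst; exists 0; first exact: (word_bool false).
    split; last by rewrite /= eqxx.
    apply: stores_set_reg => //; apply: stores_ext hst => l l0 x y.
    rewrite /insert /X take0 (_ : [exists z, _] = false) ?andbF ?orbF //.
    by apply/existsP=> -[].
  have body i : i < #|G| -> runs W
      (Seq (compile k (size rho).+1 r) (increment (size rho).+1))
      (I i) (I i.+1) (T i).
    move=> lt_iN.
    have iz : index (nth x0 vs i) vs = i by rewrite index_uniq ?size_vs.
    rewrite /T; set z := nth x0 vs i in iz *.
    have := IH (rcons rho z) (insert B k (X i)); rewrite size_rcons => /(_ wfr).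
    rewrite (cost_insert _ _ _ wfr) => run_r.
    apply: (runs_seq (Q := fun st =>
      stores rho (insert B k (X i.+1)) st /\ reg st (size rho).+1 = i)).
      apply: runs_weaken run_r _ _ (leqnn _) => st.
        by case=> hst hi; apply/stores_rcons; rewrite hi iz.
      case/stores_rcons=> hst hi; split; last by rewrite hi.
      apply: stores_ext hst => l l0 x y; rewrite /insert -orbA -andb_orr.
      congr (_ || (_ && _)); rewrite (rule_rel_insert _ _ _ wfr) /X.
      rewrite (take_nth x0) ?size_vs //; apply/orP/exists_inP.
        case=> [/exists_inP[u u_i du]|dz]; [exists u|exists z] => //;
          by rewrite mem_rcons inE ?u_i ?orbT ?eqxx.
      case=> u; rewrite mem_rcons => /predU1P[->|u_i] du; [by right|left].
      by apply/exists_inP; exists u.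
    apply: runs_setreg => st [hst hi]; exists i.+1.
      rewrite /= hi (word_le (ltnW lt_iN)) /= (word_bool true) /= addn1.
      exact: word_le.
    by split; [apply: stores_set_reg | rewrite /= eqxx].
  have loop := runs_while (e := Bin Lt (Reg (size rho).+1) (Reg 0)) _ body.
  apply: runs_weaken (runs_seq init (loop _)) (fun _ h => h) _ _.
  + move=> i st le_iN [[h0 _ _] hi].
    by rewrite /= hi h0 !word_le //= word_bool.
  + move=> st [hst _]; apply: stores_ext hst => l l0 x y; rewrite /insert /X.
    rewrite -size_vs take_size; congr (_ || (_ && _)).
    by apply: eq_existsb => z; rewrite mem_vs.
  + rewrite /T -size_vs.
    (* Each iteration costs 4 for the increment and 4 for the test. *)
    rewrite (eq_bigr (fun i => 8 + cost B (rcons rho (nth x0 vs i)) r));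
      last by move=> i _ /=; lia.
    rewrite -(big_nth x0 xpredT (fun z => 8 + cost B (rcons rho z) r)).
    rewrite big_uniq //= (eq_bigl _ _ mem_vs).
    rewrite addnCA addnC leq_add //.
    by apply: leq_sum => z _; rewrite leq_add2r.
Qed.

End Correct.
End Rules.

(** * The decision program *)

(** A list of rules, each with the array that receives its result. *)
Definition program := seq (nat * rule).

Fixpoint compile_program (p : program) : cmd :=
  if p is (k, r) :: p' then Seq (compile k 1 r) (compile_program p') else Skip.

Definition well_formed_program : pred program :=
  all (fun kr => (0 < kr.1) && well_formed kr.1 1 kr.2).

(** With [x] and [y] the variables 1 and 2: some neighbours [u] of [x] and [w]
    of [y] are not adjacent. The case [u = w] needs no test of its own, since a
    vertex is not adjacent to itself. *)
Definition nonbisimplicial_body : rule :=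
  Loop (Guard true 1 1 3
    (Loop (Guard true 1 2 4 (Guard false 1 3 4 (Put 1 2))))).

(** A set of vertices is stored on the diagonal of a relation. *)
Definition covered_body : rule := Guard false 2 1 2 (Put 1 1).

(** A Boolean flag is stored as the pair of the fixed vertex with itself. *)
Definition triangle_body : rule :=
  Loop (Guard true 1 2 3 (Guard true 1 1 3 (Put 0 0))).

Definition uncovered_body : rule := Guard false 3 1 1 (Put 0 0).

(** Array 1 holds the adjacency matrix. Both reasons to reject share the flag
    in array 4. *)
Definition cdc_bodies : program :=
  [:: (2, nonbisimplicial_body); (3, covered_body); (4, triangle_body);
      (4, uncovered_body)].

Definition cdc_program : program :=
  [seq (kr.1, over_arcs kr.2) | kr <- cdc_bodies].

(** Register 2 counts the vertices, register 3 is the position in the input and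
    register 4 the end of the current adjacency list.  Register 1 is left at 0:
    it holds the number of the fixed vertex used by the rules. *)
Definition parse_neighbour : cmd :=
  Seq (SetArr 1 (Bin Add (Bin Mul (Reg 2) (Reg 0)) (Get 0 (Reg 3))) (Const 1))
      (increment 3).

Definition parse_vertex : cmd :=
  Seq (SetReg 4 (Bin Add (Bin Add (Reg 3) (Const 1)) (Get 0 (Reg 3))))
 (Seq (increment 3)
 (Seq (While (Bin Lt (Reg 3) (Reg 4)) parse_neighbour)
      (increment 2))).

Definition parse : cmd :=
  Seq (SetReg 0 (Get 0 (Const 0)))
 (Seq (SetReg 3 (Const 1))
      (While (Bin Lt (Reg 2) (Reg 0)) parse_vertex)).

Definition decide_cdc : cmd :=
  Seq parse
 (Seq (compile_program cdc_program)
      (SetReg 0 (Bin Eq (Get 4 (Const 0)) (Const 0)))).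

Section Program.
Variables (G : sgraph) (x0 : G).
Implicit Types (B : nat -> rel G) (x y z u w : G).

Fixpoint program_db B (p : program) : nat -> rel G :=
  if p is (k, r) :: p' then program_db (insert B k (rule_rel x0 B [:: x0] r)) p'
  else B.

Fixpoint cost_program B (p : program) : nat :=
  if p is (k, r) :: p' then
    cost x0 B [:: x0] r + cost_program (insert B k (rule_rel x0 B [:: x0] r)) p'
  else 1.

Definition adjacency_db : nat -> rel G := fun k x y => (k == 1) && edge x y.

Lemma rule_rel_nonbisimplicial B : B 1 =2 @edge G ->
  rule_rel x0 B [:: x0] (over_arcs nonbisimplicial_body)
    =2 (fun x y => edge x y && ~~ bisimplicial x y).
Proof.
move=> BE x y; apply/existsP/andP => /= [[x' /existsP[y']]|[xy]].
  rewrite BE eqb_id => /andP[xy /existsP[u]]; rewrite BE eqb_id.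
  case/andP=> xu /existsP[w]; rewrite !BE eqb_id eqbF_neg.
  case/and4P=> yw nuw /eqP-> /eqP->; split=> //; rewrite /bisimplicial xy.
  by apply/forallPn; exists u; apply/forallPn; exists w; rewrite xu yw.
rewrite /bisimplicial xy => /forallPn[u /forallPn[w]].
rewrite !negb_imply => /and3P[xu yw nuw].
exists x; apply/existsP; exists y; rewrite BE xy /=.
apply/existsP; exists u; rewrite BE xu /=.
by apply/existsP; exists w; rewrite !BE yw (negPf nuw) !eqxx.
Qed.

Lemma rule_rel_covered B :
  B 1 =2 @edge G -> B 2 =2 (fun x y => edge x y && ~~ bisimplicial x y) ->
  rule_rel x0 B [:: x0] (over_arcs covered_body)
    =2 (fun x y => (x == y) && [exists z, bisimplicial x z]).
Proof.
move=> B1 B2 x y; apply/existsP/andP => /= [[x' /existsP[z]]|[/eqP<-]].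
  rewrite B1 B2 eqb_id eqbF_neg => /and4P[xz]; rewrite xz /= negbK => bxz.
  by move=> /eqP-> /eqP->; split=> //; apply/existsP; exists z.
case/existsP=> z bxz; exists x; apply/existsP; exists z.
by rewrite B1 B2 bxz andbF; case/andP: bxz => -> _; rewrite !eqxx.
Qed.

Lemma rule_rel_triangle B : B 1 =2 @edge G ->
  rule_rel x0 B [:: x0] (over_arcs triangle_body) x0 x0 = ~~ triangle_free G.
Proof.
move=> BE; rewrite negbK /=; apply: eq_existsb => x.
apply/existsP/existsP=> -[y h]; exists y.
  move: h; rewrite BE eqb_id => /andP[xy /existsP[z]].
  rewrite !BE !eqb_id => /and3P[yz xz _].
  by apply/existsP; exists z; rewrite xy yz.
case/existsP: h => z /and3P[xy yz xz]; rewrite BE xy /=.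
by apply/existsP; exists z; rewrite !BE yz xz !eqxx.
Qed.

Lemma rule_rel_uncovered B : B 1 =2 @edge G ->
  B 3 =2 (fun x y => (x == y) && [exists z, bisimplicial x z]) ->
  rule_rel x0 B [:: x0] (over_arcs uncovered_body) x0 x0
    = ~~ bisimplicially_covered G.
Proof.
move=> B1 B3; rewrite negb_forall /=; apply: eq_existsb => x.
rewrite negb_imply; apply/existsP/andP.
  case=> y; rewrite B1 B3 eqb_id eqbF_neg !eqxx !andbT => /andP[xy ->].
  by split=> //; apply/isolatedPn; exists y.
by case=> /isolatedPn[y xy] nb; exists y; rewrite B1 B3 xy eqbF_neg !eqxx nb.
Qed.

(** The final flag is the negation of the answer: it is raised by a triangle,
    or by a non-isolated vertex in no bisimplicial edge. *)
Lemma program_db_cdc :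
  program_db adjacency_db cdc_program 4 x0 x0 = ~~ (triangle_free G && CDC G).
Proof.
pose derive B k body := insert B k (rule_rel x0 B [:: x0] (over_arcs body)).
pose B2 := derive adjacency_db 2 nonbisimplicial_body.
pose B3 := derive B2 3 covered_body; pose B4 := derive B3 4 triangle_body.
change (derive B4 4 uncovered_body 4 x0 x0 = ~~ (triangle_free G && CDC G)).
pose E := @edge G.
have A1 : adjacency_db 1 =2 E by [].
have A2 : B2 1 =2 E by move=> u v; rewrite /B2 /derive insert_other // A1.
have A3 : B3 1 =2 E by move=> u v; rewrite /B3 /derive insert_other // A2.
have A4 : B4 1 =2 E by move=> u v; rewrite /B4 /derive insert_other // A3.
have D2 : B2 2 =2 (fun x y => edge x y && ~~ bisimplicial x y).
  by move=> x y; rewrite -(rule_rel_nonbisimplicial A1).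
have D3 : B3 3 =2 (fun x y => (x == y) && [exists z, bisimplicial x z]).
  by move=> x y; rewrite -(rule_rel_covered A2 D2).
have D4 : B4 3 =2 (fun x y => (x == y) && [exists z, bisimplicial x z]).
  by move=> x y; rewrite /B4 /derive insert_other.
rewrite {1}/derive {1}/insert eqxx (rule_rel_uncovered A4 D4).
rewrite {1}/B4 {1}/derive {1}/insert eqxx (rule_rel_triangle A3) /=.
rewrite negb_and; case tf: (triangle_free G) => //=.
by rewrite triangle_free_CDC.
Qed.

Lemma cost_program_over_arcs B q m :
  B 1 =2 @edge G -> arc_number G <= 2 * m ->
  all (fun kr => (kr.1 != 1) && (depth kr.2 <= 2)) q ->
  cost_program B [seq (kr.1, over_arcs kr.2) | kr <- q]
    <= (1 + \sum_(kr <- q) (50 + 2 * weight kr.2)) * (#|G| * (#|G| + m) ^ 2).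
Proof.
move=> BE le_m; elim: q B BE => [|[k r] q IH] B BE.
  by rewrite big_nil -mulnn !muln_gt0 !addn_gt0 !vertex_gt0.
move=> /= /andP[/andP[k1 d2] wfq]; rewrite big_cons addnCA mulnDl.
rewrite leq_add ?cost_over_arcs_le //; apply: IH => // x y.
by rewrite insert_other // eq_sym.
Qed.

Section Correct.
Variables (W : nat) (vs : seq G).
Hypothesis vs_uniq : uniq vs.
Hypothesis vsE : vs =i G.
Hypothesis W_large : #|G|.+1 ^ 2 <= W.

Lemma compile_program_correct p B : well_formed_program p ->
  runs W (compile_program p) (stores x0 vs [:: x0] B)
    (stores x0 vs [:: x0] (program_db B p)) (cost_program B p).
Proof.
elim: p B => [|[k r] p IH] B /=.
  by move=> _ st h; exists 1, st; split=> //; apply: ExecSkip.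
case/andP=> /andP[/= k0 wfr] /IH h.
have run_r :=
  compile_correct (x0 := x0) (rho := [:: x0]) vs_uniq vsE W_large k0 wfr.
exact: runs_seq (run_r B) (h _).
Qed.

Section Parse.
Variables (nbr : G -> seq G) (s : seq nat).
Hypothesis nbr_uniq : forall v, uniq (nbr v).
Hypothesis nbrE : forall v, nbr v =i edge v.
Hypothesis x0_first : index x0 vs = 0.

Let list_code v := size (nbr v) :: [seq index u vs | u <- nbr v].
Hypothesis s_code : s = size vs :: flatten [seq list_code v | v <- vs].
Hypothesis s_words : size s < W.

Lemma word_position p : p <= size s -> word W p = Some p.
Proof. by rewrite /word => h; rewrite (leq_ltn_trans h s_words). Qed.

(** The parser has reached vertex number [i] and input position [p], the
    current list ends at [e], and the adjacency matrix contains [X]. *)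
Definition parsing i p e (X : rel G) st : Prop :=
  [/\ [/\ reg st 0 = #|G|, reg st 1 = 0, reg st 2 = i, reg st 3 = p
       & reg st 4 = e],
      forall j, arr st 0 j = nth 0 s j
    & forall k x y, 0 < k -> arr st k (cell_index vs x y) = (k == 1) && X x y].

Lemma parsing_ext i p e X Y st :
  X =2 Y -> parsing i p e X st -> parsing i p e Y st.
Proof.
by move=> XY [hr ha hk]; split=> // k x y k0; rewrite hk // XY.
Qed.

Lemma parse_neighbour_correct p e X v u :
  p < size s -> nth 0 s p = index u vs ->
  runs W parse_neighbour (parsing (index v vs) p e X)
    (parsing (index v vs) p.+1 e
       (fun x y => X x y || ((x == v) && (y == u)))) 12.
Proof.
move=> lt_p s_p; have iv := index_vs vs_uniq vsE v.
have iu := index_vs vs_uniq vsE u.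
pose Y := fun x y => X x y || ((x == v) && (y == u)).
apply: (runs_seq (Q := parsing (index v vs) p e Y) (T1 := 8) (T2 := 4)).
  apply: runs_setarr => st [[h0 h1 h2 h3 h4] ha hk].
  exists (cell_index vs v u), 1; split.
  - rewrite /= h0 h2 h3 (word_le W_large (ltnW iv)) /=.
    rewrite (word_le W_large (leqnn _)) /=.
    rewrite (word_small W_large (v := _ * _)) /=; last first.
      by rewrite -mulnn ltn_mul // ltnS // ltnW.
    rewrite (word_position (ltnW lt_p)) /= ha s_p.
    rewrite (word_le W_large (ltnW iu)) /=; exact: word_cell_index.
  - exact: (word_bool W_large true).
  - split=> //= k x y k0; rewrite (cell_index_eq x0) // hk // /Y.
    by case: (k == 1) => //=; case: (_ && _); rewrite ?orbT ?orbF.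
apply: runs_setreg => st [[h0 h1 h2 h3 h4] ha hk]; exists p.+1 => //.
rewrite /= h3 (word_position (ltnW lt_p)) /= (word_bool W_large true) /=.
rewrite addn1; exact: word_position.
Qed.

(** The unread input is described by [drop]; this avoids computing the position
    of each adjacency list. *)
Lemma parse_vertex_correct i p e rest :
  i < #|G| -> drop p s = list_code (nth x0 vs i) ++ rest ->
  runs W parse_vertex
    (parsing i p e (fun x y => (x \in take i vs) && edge x y))
    (fun st => exists2 p', drop p' s = rest &
       parsing i.+1 p' p' (fun x y => (x \in take i.+1 vs) && edge x y) st)
    (19 + 16 * #|G|).
Proof.
move=> lt_i; set v := nth x0 vs i => drop_p.
have iv : index v vs = i by rewrite index_uniq ?(size_vs vs_uniq vsE).
set d := size (nbr v).
have le_d : d <= #|G| by rewrite /d -(card_uniqP (nbr_uniq v)) max_card.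
have s_p : nth 0 s p = d by rewrite -[p]addn0 -nth_drop drop_p.
have s_j j : j < d -> nth 0 s (p.+1 + j) = index (nth x0 (nbr v) j) vs.
  move=> lt_j; rewrite addSnnS -nth_drop drop_p /= nth_cat size_map lt_j.
  by rewrite (nth_map x0).
have le_end : p.+1 + d <= size s.
  have := congr1 size drop_p; rewrite size_drop size_cat /= size_map -/d; lia.
have lt_p : p < size s by apply: leq_trans le_end; rewrite leq_addr.
have drop_end : drop (p.+1 + d) s = rest.
  by rewrite addSnnS addnC -drop_drop drop_p /= drop_size_cat // size_map //.
pose X x y := (x \in take i vs) && edge x y.
pose J j := parsing i (p.+1 + j) (p.+1 + d)
  (fun x y => X x y || ((x == v) && (y \in take j (nbr v)))).
have run_end :
  runs W (SetReg 4 (Bin Add (Bin Add (Reg 3) (Const 1)) (Get 0 (Reg 3))))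
    (parsing i p e X) (parsing i p (p.+1 + d) X) 7.
  apply: runs_setreg => st [[h0 h1 h2 h3 h4] ha hk]; exists (p.+1 + d) => //.
  rewrite /= h3 (word_position (ltnW lt_p)) /= (word_bool W_large true) /=.
  rewrite addn1 ha s_p (word_le W_large le_d) (word_position lt_p) /=.
  exact: word_position.
have run_next : runs W (increment 3) (parsing i p (p.+1 + d) X) (J 0) 4.
  apply: runs_setreg => st [[h0 h1 h2 h3 h4] ha hk]; exists p.+1.
    rewrite /= h3 (word_position (ltnW lt_p)) /= (word_bool W_large true) /=.
    rewrite addn1; exact: word_position.
  split=> [|//|k x y k0 /=]; first by split; rewrite //= addn0.
  by rewrite hk // take0 andbF orbF.
have run_loop :
  runs W (While (Bin Lt (Reg 3) (Reg 4)) parse_neighbour) (J 0) (J d)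
    (\sum_(0 <= j < d) (12 + 4) + 4).
  apply: runs_while => [j st le_j [[_ _ _ h3 h4] _ _]|j lt_j].
    rewrite /= h3 h4 !word_position //=; last first.
      by apply: leq_trans le_end; rewrite leq_add2l.
    by rewrite ltn_add2l (word_bool W_large).
  have lt_pj : p.+1 + j < size s by apply: leq_trans le_end; rewrite ltn_add2l.
  rewrite /J -iv.
  have run_nbr := parse_neighbour_correct (v := v) lt_pj (s_j _ lt_j).
  apply: runs_weaken (run_nbr _ _) _ _ _.
  + by move=> st hst; exact: hst.
  + move=> st; rewrite addnS; apply: parsing_ext => x y.
    by rewrite (take_nth x0 lt_j) mem_rcons inE -orbA -andb_orr
      [(y == _) || _]orbC.
  + by [].
have run_last : runs W (increment 2) (J d)
    (fun st => exists2 p', drop p' s = rest &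
       parsing i.+1 p' p' (fun x y => (x \in take i.+1 vs) && edge x y) st) 4.
  apply: runs_setreg => st hst; exists i.+1.
    case: hst => [[_ _ h2 _ _] _ _].
    rewrite /= h2 (word_le W_large (ltnW lt_i)) /= (word_bool W_large true) /=.
    rewrite addn1; exact: (word_le W_large lt_i).
  exists (p.+1 + d) => //.
  apply: (@parsing_ext _ _ _ (fun x y => X x y || ((x == v) && (y \in nbr v)))).
    move=> x y; rewrite (take_nth x0) ?(size_vs vs_uniq vsE) // mem_rcons inE.
    by rewrite -/v /X nbrE andb_orl orbC; case: eqP => // ->.
  by move: hst; rewrite /J take_size => -[[h0 h1 h2 h3 h4] ha hk].
apply: runs_weaken
  (runs_seq run_end (runs_seq run_next (runs_seq run_loop run_last)))
  _ _ _ => //.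
rewrite sum_nat_const_nat; lia.
Qed.

Lemma parse_correct :
  runs W parse (fun st => st = init s) (stores x0 vs [:: x0] adjacency_db)
    (50 * #|G| ^ 2).
Proof.
have n0 := vertex_gt0 G; have sz := size_vs vs_uniq vsE.
pose X i x y := (x \in take i vs) && edge x y.
pose I i st := exists p e,
  drop p s = flatten [seq list_code v | v <- drop i vs] /\
  parsing i p e (X i) st.
have run_size : runs W (SetReg 0 (Get 0 (Const 0))) (fun st => st = init s)
    (parsing 0 0 0 (X 0)) 3.
  apply: runs_setreg => st ->; exists #|G|.
    by rewrite /= (word_bool W_large false) /= s_code /= sz (word_le W_large).
  by split=> // k x y k0; rewrite /= (gtn_eqF k0) /X take0 /= andbF.
have run_start : runs W (SetReg 3 (Const 1)) (parsing 0 0 0 (X 0)) (I 0) 2.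
  apply: runs_setreg => st [[h0 h1 h2 h3 h4] ha hk]; exists 1.
    exact: (word_bool W_large true).
  by exists 1, 0; split=> //; rewrite s_code /= !drop0.
have run_loop :
  runs W (While (Bin Lt (Reg 2) (Reg 0)) parse_vertex) (I 0) (I #|G|)
    (\sum_(0 <= i < #|G|) (19 + 16 * #|G| + 4) + 4).
  apply: runs_while => [i st le_i [p [e [_ [[h0 _ h2 _ _] _ _]]]]|i lt_i].
    by rewrite /= h0 h2 !(word_le W_large) //= (word_bool W_large).
  move=> st [p [e [drop_p hst]]].
  rewrite (drop_nth x0) ?sz //= in drop_p.
  have [t [st' [ex [p' drop_p' hst'] le_t]]] :=
    parse_vertex_correct lt_i drop_p hst.
  by exists t, st'; split=> //; exists p', p'.
apply: runs_weaken
  (runs_seq run_size (runs_seq run_start run_loop)) _ _ _ => //.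
  move=> st [p [e [_ [[h0 h1 h2 h3 h4] ha hk]]]]; split=> // [[|//] _|k x y k0].
    by rewrite h1 x0_first.
  by rewrite hk // /X -sz take_size mem_vs.
rewrite sum_nat_const_nat subn0 -mulnn; have := leq_pmulr #|G| n0.
move: #|G| n0 => n n0; nia.
Qed.

(** The fixed vertex has number 0, so its flag is cell 0 of array 4. *)
Lemma decide_cdc_correct :
  exists2 t, decides_in W decide_cdc s t (triangle_free G && CDC G) &
    t <= 50 * #|G| ^ 2 + (cost_program adjacency_db cdc_program + 5).
Proof.
pose final st := reg st 0 = (triangle_free G && CDC G).
have run_out : runs W (SetReg 0 (Bin Eq (Get 4 (Const 0)) (Const 0)))
    (stores x0 vs [:: x0] (program_db adjacency_db cdc_program)) final 5.
  apply: runs_setreg => st [h0 hr ha].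
  have := ha 4 x0 x0 isT; rewrite /cell_index x0_first program_db_cdc /= => bad.
  exists (triangle_free G && CDC G); last by [].
  have w0 : word W 0 = Some 0 := word_bool W_large false.
  rewrite /= w0 /= bad (word_bool W_large) /= (word_bool W_large).
  by case: (_ && _).
have wf_cdc : well_formed_program cdc_program by [].
have run := runs_seq parse_correct
  (runs_seq (compile_program_correct (B := adjacency_db) wf_cdc) run_out).
have [t [st [ex ans le_t]]] := run (init s) erefl.
by exists t => //; exists st.
Qed.

End Parse.
End Correct.
End Program.

(** * Time and word bounds in terms of the graph *)

(** Each edge is the set of ends of at most two arcs. *)
Lemma arc_number_le (G : sgraph) : arc_number G <= 2 * #|edges G|.
Proof.
pose arcs := [set p : G * G | edge p.1 p.2].
pose ends (p : G * G) := [set p.1; p.2].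
have -> : arc_number G = \sum_(p in arcs) 1.
  rewrite /arc_number pair_big /= big_mkcond /=.
  by rewrite [RHS]big_mkcond; apply: eq_bigr => p _; rewrite inE; case: edge.
rewrite (partition_big ends (mem (edges G))) /=; last first.
  move=> [x y]; rewrite !inE /= => xy.
  by apply/existsP; exists x; apply/existsP; exists y; rewrite xy eqxx.
rewrite mulnC -sum_nat_const leq_sum // => A.
rewrite inE => /existsP[x /existsP[y /andP[xy /eqP->]]].
rewrite sum1dep_card; apply: (@leq_trans #|[set (x, y); (y, x)]|); last first.
  by rewrite cards2; case: eqP.
apply/subset_leq_card/subsetP=> -[u w]; rewrite !inE /= => /andP[uw /eqP e].
have nuw := edge_neq uw.
have : u \in [set x; y] by rewrite -e set21.
have : w \in [set x; y] by rewrite -e set22.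
by rewrite !inE => /orP[] /eqP wE /orP[] /eqP uE; subst;
  rewrite ?eqxx ?orbT // in nuw *.
Qed.

Lemma leq_size_flatten_cons (S T : Type) (f : S -> T) (g : S -> seq T) l :
  size l <= size (flatten [seq f v :: g v | v <- l]).
Proof.
elim: l => //= v l IH; rewrite ltnS size_cat.
exact: leq_trans IH (leq_addl _ _).
Qed.

(* Words have O(log |input|) bits: values are bounded by (size s) ^ k. *)
Theorem theorem6p20 :
  exists (P : cmd) (k C : nat),
    forall (G : sgraph) (s : seq nat), adjacency_code G s ->
    exists2 t : nat,
      decides_in (size s ^ k) P s t (triangle_free G && CDC G)
      & t <= C * (#|G| * (#|G| + #|edges G|) ^ 2).
Proof.
(* Exponent 2 suffices for the addresses of a matrix, as the input is longer
   than the number of vertices. The term 55 pays for the parser (50) and for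
   reading the flag (5). *)
pose K := 1 + \sum_(kr <- cdc_bodies) (50 + 2 * weight kr.2).
exists decide_cdc, 2, (55 + K) => G s [vs [nbr [vs_uniq vsE nbrP s_code]]].
case: vs vs_uniq vsE s_code => [|x0 vs'].
  by move=> _ vsE; have /card_gt0P[x _] := vertex_gt0 G; have := vsE x.
set vs := x0 :: vs' => vs_uniq vsE s_code.
have n0 := vertex_gt0 G.
have size_s : #|G| < size s.
  by rewrite s_code -(size_vs vs_uniq vsE) ltnS leq_size_flatten_cons.
have [|||t dec le_t] := decide_cdc_correct (x0 := x0) (W := size s ^ 2)
  vs_uniq vsE _ (fun v => (nbrP v).1) (fun v => (nbrP v).2) _ s_code _.
- by rewrite leq_exp2r.
- by rewrite /= eqxx.
- by rewrite -mulnn ltn_Pmull // (leq_ltn_trans _ size_s).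
exists t => //; apply: leq_trans le_t _.
have cost_le : cost_program x0 (@adjacency_db G) cdc_program <=
    K * (#|G| * (#|G| + #|edges G|) ^ 2).
  by apply: cost_program_over_arcs => //; apply: arc_number_le.
have : #|G| ^ 2 <= #|G| * (#|G| + #|edges G|) ^ 2.
  rewrite -!mulnn (leq_trans (leq_pmull _ n0)) // leq_mul2l.
  by rewrite leq_mul ?orbT ?leq_addr.
have : 0 < #|G| ^ 2 by rewrite expn_gt0 n0.
move: cost_le; rewrite mulnDl.
by move: (#|G| * _) (#|G| ^ 2) (cost_program _ _ _) (K * _); lia.
Qed.
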